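(* Let $S_{0,1}$ be the set of parameters $c\in\mathbb{C}$ such that $z=0$ and $z=1$ are both preperiodic under iteration of $f_c(z)=z^2+c$. If $c\in S_{0,1}$, then $c$ is algebraic over $\mathbb{Q}$ and $[\mathbb{Q}(c):\mathbb{Q}]\le 108$.
   Context: A point $z$ is preperiodic under $f_c$ if its forward orbit $\{f_c^n(z):n\ge 0\}$ is finite, where $f_c^n$ denotes the $n$-th iterate of $f_c$. *)

(* Defs.v *)
From mathcomp Require Import all_boot all_order all_algebra.
From mathcomp Require Import complex.
From mathcomp Require Import mathcomp_extra boolp classical_sets functions cardinality reals.

Set Implicit Arguments.
Unset Strict Implicit.
Unset Printing Implicit Defensive.

Import Order.TTheory GRing.Theory Num.Theory.
Local Open Scope classical_set_scope.
Local Open Scope ring_scope.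

Definition preperiodic (T : Type) (f : T -> T) (z : T) : Prop :=
  finite_set (range (fun n : nat => iter n f z)).

Definition quadratic_map (F : numFieldType) (c z : F) : F := z ^+ 2 + c.

Definition S01 (F : numFieldType) : set F :=
  [set c | preperiodic (quadratic_map c) 0 /\ preperiodic (quadratic_map c) 1].

(* In a field, closure under 1, subtraction and division is exactly being a
   subfield: x / 0 is 0, which belongs to every such set.  As F has
   characteristic 0, every subfield contains the rationals, so the smallest
   one containing c is Q(c). *)
Definition Qadjoin (F : numFieldType) (c : F) : set F :=
  smallest (fun K : set F => divring_closed (mem K)) [set c].

Definition Qcomb (F : numFieldType) (n : nat) (v : 'I_n -> F)
    (a : 'I_n -> rat) : F :=
  \sum_(i < n) ratr (a i) * v i.

Definition Qbasis (F : numFieldType) (K : set F) (n : nat)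
    (v : 'I_n -> F) : Prop :=
  (forall a : 'I_n -> rat, Qcomb v a = 0 -> forall i, a i = 0) /\
  K = range (Qcomb v).

(* [K : Q] is finite and equal to n. *)
Definition Qdegree (F : numFieldType) (K : set F) (n : nat) : Prop :=
  exists v : 'I_n -> F, Qbasis K v.

(* Main.v *)
Require Import Defs.
From mathcomp Require Import all_boot all_order all_algebra.
From mathcomp Require Import complex ring lra algebraics_fundamentals.
From mathcomp Require Import mathcomp_extra boolp classical_sets functions cardinality reals.

(** In fact [S01] contains no parameter besides 0, -1 and -2, so that Q(c) is
always Q.  The proof bounds the integer polynomial
[H = (X + 1)^3 * X * (X + 2)] on the parameters in question and then uses that
a nonzero integer has absolute value at least 1.

Arithmetic side.  If 0 is preperiodic for c, then c is a root of a monic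
integer polynomial, so its minimal polynomial G over Q has integer
coefficients.  The two equalities between iterates that make 0 and 1
preperiodic are polynomial equations in c over the integers, hence every root
of G satisfies them too ([integral_minimal_poly]).  The product of [H z] over
the roots z of G is, up to sign, the integer [G(-1)^3 * G(0) * G(-2)].  If
[`|H z| < 1] for every such z, this integer vanishes
([integer_root_of_small_values]), and the irreducible G is then X, X + 1 or
X + 2.

Analytic side.  When 0 is preperiodic, every preperiodic orbit stays in the
disc of radius 2 ([collision_bounded]).  So it suffices that [`|H c| < 1] as soon as
the third iterates of 0 and of 1 have modulus at most 2 ([auxiliary_lt1]).
Put [u = c + 1], [a = `|u|^2], [b = Re u] and [B = `|u^2 - 1|^2].  Then
[`|H c|^2 = a^3 * B], and [B + 4 * b^2 = (a + 1)^2].  Trading [b^2] for B turns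
the squared moduli of the third iterates into polynomials in a, b and B where,
as soon as [1 <= a^3 * B], positive quantities multiply b for the orbit of 1
and -b for the orbit of 0.  Hence the orbit of 1 escapes when [0 <= b]
([right_half_plane_escape]) and the orbit of 0 escapes when [b <= 0]
([left_half_plane_escape]).

The factors X and X + 2 of H are there because 0 and -2 are parameters at which
[X + 1] has modulus exactly 1.  The exponent 3 is the one for which the lower
bound that [0 <= b] gives for the squared modulus of the third iterate of 1,
namely [2 a^3 - a + 1/a + 2/a^2], is minimal at [a = 1], where it equals 4. *)

Set Implicit Arguments.
Unset Strict Implicit.
Unset Printing Implicit Defensive.

Import Order.TTheory GRing.Theory Num.Theory.
Local Open Scope classical_set_scope.
Local Open Scope ring_scope.

(** * Two inequalities for the third iterates *)

Lemma planar_B_gt0 (R : realFieldType) (a B : R) :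
  0 < a -> 1 <= a ^+ 3 * B -> 0 < B.
Proof.
move=> a_gt0 aB_ge1.
by rewrite -(pmulr_rgt0 _ (exprn_gt0 3 a_gt0)) (lt_le_trans ltr01).
Qed.

Lemma planar_B_ge1 (R : realFieldType) (a B : R) :
  0 < a -> 1 <= a ^+ 3 * B -> a < 1 -> 1 <= B.
Proof.
move=> a_gt0 aB_ge1 a_lt1; apply: (le_trans aB_ge1).
apply: ler_piMl; first exact: ltW (planar_B_gt0 a_gt0 aB_ge1).
by apply: exprn_ile1; apply: ltW.
Qed.

(** The constant 2/3 is a rational lower bound of the positive root, about 0.70,
of [a ^+ 3 * (a + 1) ^+ 2 = 1]. *)
Lemma planar_a_gt (R : realFieldType) (a b B : R) :
  0 < a -> B + 4 * b ^+ 2 = (a + 1) ^+ 2 -> 1 <= a ^+ 3 * B -> 2 / 3 < a.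
Proof.
move=> a_gt0 defB aB_ge1; have B_gt0 := planar_B_gt0 a_gt0 aB_ge1.
have B_le : B <= (a + 1) ^+ 2 by rewrite -defB; nra.
rewrite ltNge; apply/negP => a_le.
have a3_le : a ^+ 3 <= (2 / 3) ^+ 3 by rewrite lerXn2r ?nnegrE //; lra.
have : (a + 1) ^+ 2 <= (5 / 3) ^+ 2 by rewrite lerXn2r ?nnegrE //; lra.
nra.
Qed.

(** The right-hand side is the squared modulus of the third iterate of 1, in
the notation [a = `|u|^2], [b = Re u], [B = `|u^2 - 1|^2] where [u = c + 1]. *)
Lemma right_half_plane_escape (R : realFieldType) (a b B : R) :
  0 < a -> B + 4 * b ^+ 2 = (a + 1) ^+ 2 -> 1 <= a ^+ 3 * B -> 0 <= b ->
  4 < a * (2 * a ^+ 2 - 1 + (a + 2) * B + 2 * b * (a ^+ 2 - a + B)).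
Proof.
move=> a_gt0 defB aB_ge1 b_ge0; have B_gt0 := planar_B_gt0 a_gt0 aB_ge1.
have a_gt := planar_a_gt a_gt0 defB aB_ge1.
have cross_gt0 : 0 < a ^+ 2 - a + B.
  have [a_ge1|/(planar_B_ge1 a_gt0 aB_ge1) B_ge1] := lerP 1 a; nra.
have [b_gt0|b_le0] := ltrP 0 b; last first.
  have b0 : b = 0 by lra.
  have -> : B = (a + 1) ^+ 2 by rewrite -defB b0; ring.
  rewrite b0; nra.
(* After multiplication by [a ^+ 2] and the bound [1 <= a ^+ 3 * B], what
   remains without b is [2 a^5 - a^3 - 4 a^2 + a + 2], which is the product
   below; the terms with b give strictness. *)
rewrite -(ltr_pM2l (exprn_gt0 2 a_gt0)).
have : 0 <= (a - 1) ^+ 2 * (2 * a ^+ 3 + 4 * a ^+ 2 + 5 * a + 2).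
  by rewrite mulr_ge0 ?sqr_ge0 // !addr_ge0 ?mulr_ge0 ?exprn_ge0 // ltW.
have : 0 < 2 * a ^+ 3 * b * (a ^+ 2 - a + B).
  by rewrite !mulr_gt0 ?exprn_gt0.
have : (a + 2) * 1 <= (a + 2) * (a ^+ 3 * B) by rewrite ler_wpM2l //; lra.
lra.
Qed.

(** The right-hand side is the squared modulus of the third iterate of 0, in
the same notation. *)
Lemma left_half_plane_escape (R : realFieldType) (a b B : R) :
  0 < a -> B + 4 * b ^+ 2 = (a + 1) ^+ 2 -> 1 <= a ^+ 3 * B -> b <= 0 ->
  4 < (a + 1 - 2 * b) * (a ^+ 3 + B - 2 * b * (a - 1 + B)).
Proof.
move=> a_gt0 defB aB_ge1 b_le0; have B_gt0 := planar_B_gt0 a_gt0 aB_ge1.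
have a_gt := planar_a_gt a_gt0 defB aB_ge1.
have a3_gt0 := exprn_gt0 3 a_gt0.
have cross_gt0 : 0 < a - 1 + B.
  have [a_ge1|/(planar_B_ge1 a_gt0 aB_ge1) B_ge1] := lerP 1 a; lra.
(* [(a ^+ 3 + B) ^+ 2 >= 4 * (a ^+ 3 * B) >= 4]. *)
have amgm : 2 <= a ^+ 3 + B.
  have := sqr_ge0 (a ^+ 3 - B); nra.
have mix_ge0 : 0 <= - 2 * b * (a - 1 + B) by nra.
(* For [1 - a <= - 2 * b] both factors are at least 2; otherwise [`|b|] is so
   small that B exceeds [(a + 1) ^+ 2 - (1 - a) ^+ 2 = 4 * a]. *)
have [small|big] := ltrP (- 2 * b) (1 - a).
  have B_gt : 4 * a < B by nra.
  nra.
have [b_lt0|b_ge0] := ltrP b 0; last first.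
  have b0 : b = 0 by lra.
  have Beq : B = (a + 1) ^+ 2 by rewrite -defB b0; ring.
  rewrite b0; nra.
have mix_gt0 : 0 < - 2 * b * (a - 1 + B) by nra.
nra.
Qed.

(** * Preperiodic orbits are bounded by 2 *)

Section Escape.
Variables (F : numFieldType) (c : F).
Local Notation f := (quadratic_map c).

Lemma preperiodic_collision (T : Type) (g : T -> T) z :
  preperiodic g z -> exists m n, (m < n)%N /\ iter m g z = iter n g z.
Proof.
move=> fin; apply: contrapT => no_collision; apply: infinite_nat.
suff inj : {in [set: nat] &, injective (fun n => iter n g z)}.
  by rewrite -(eq_finite_set (inj_card_eq inj)).
move=> m n _ _ eq_mn; apply: contrapT => /eqP; rewrite neq_ltn => /orP[] lt_mn.
- by apply: no_collision; exists m, n.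
- by apply: no_collision; exists n, m.
Qed.

(** Beyond radius 2 the term [z ^+ 2] dominates [c], as long as z is at least
as large as c: [`|z|^2 - `|c| >= `|z| * (`|z| - 1) > `|z|]. *)
Lemma escape_step z : `|c| <= `|z| -> 2 < `|z| -> `|z| < `|f z|.
Proof.
move=> cz z2; have z0 : 0 < `|z| by apply: lt_trans z2.
have: `|z| * 1 < `|z| * (`|z| - 1) by rewrite ltr_pM2l // ltrBrDr.
rewrite mulr1 mulrBr mulr1 => /lt_le_trans; apply.
apply: le_trans (lerB_normD _ _); rewrite normrX expr2.
by rewrite lerD2l lerN2.
Qed.

Lemma escape_increasing z m n : `|c| <= `|z| -> 2 < `|z| -> (m < n)%N ->
  `|iter m f z| < `|iter n f z|.
Proof.
move=> cz z2.
have step k : [/\ `|c| <= `|iter k f z|, 2 < `|iter k f z| &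
    `|iter k f z| < `|iter k.+1 f z|].
  elim: k => [|k [ck k2 lt_k]]; first by split=> //; exact: escape_step.
  have ck1 := le_trans ck (ltW lt_k); have k12 := lt_trans k2 lt_k.
  by split=> //; apply: escape_step.
apply: (homo_ltn (r := fun x y => x < y) (f := fun k => `|iter k f z|)).
  by move=> y x w; apply: lt_trans.
by move=> k; case: (step k).
Qed.

(** An orbit point beyond radius 2 would start a sequence of strictly
increasing moduli, which no eventually periodic orbit contains.  The
disjunction serves the critical orbit, whose point [c] is compared with itself
before [`|c| <= 2] is available. *)
Lemma collision_le2 z m n k : (m < n)%N -> iter m f z = iter n f z ->
  `|c| <= `|iter k f z| \/ `|c| <= 2 -> `|iter k f z| <= 2.
Proof.
move=> lt_mn eq_mn cz; rewrite real_leNgt ?ger0_real //.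
apply/negP => k2; have ck : `|c| <= `|iter k f z|.
  by case: cz => // /le_trans; apply; apply: ltW.
have := escape_increasing ck k2 lt_mn.
by rewrite -!iterD ![(_ + k)%N]addnC !iterD eq_mn ltxx.
Qed.

End Escape.

(** The parameter c is itself a point of the critical orbit, so preperiodicity
of 0 gives [`|c| <= 2], and then every other orbit can be treated. *)
Lemma collision_bounded (F : numFieldType) (c z : F) m n k l p :
  (m < n)%N -> iter m (quadratic_map c) 0 = iter n (quadratic_map c) 0 ->
  (k < l)%N -> iter k (quadratic_map c) z = iter l (quadratic_map c) z ->
  `|iter p (quadratic_map c) z| <= 2.
Proof.
move=> lt_mn eq_mn lt_kl eq_kl; apply: collision_le2 lt_kl eq_kl _; right.
have f0 : iter 1 (quadratic_map c) 0 = c by rewrite /= /quadratic_map expr0n add0r.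
by have := collision_le2 (k := 1) lt_mn eq_mn; rewrite f0; apply; left.
Qed.

(** * The auxiliary polynomial is small on the bounded parameters *)

Section SquaredModulus.
Variable R : rcfType.
Local Notation sqmod z := (complex.Re z ^+ 2 + complex.Im z ^+ 2).

Lemma norm_le2 (z : R[i]) : `|z| <= 2 -> sqmod z <= 4.
Proof.
move=> z2; rewrite -lecR add_Re2_Im2.
have -> : (4 : R)%:C%C = 2 ^+ 2 by rewrite -natrX rmorph_nat.
by rewrite lerXn2r ?nnegrE.
Qed.

(** After passing to squared moduli, the half-plane containing [c + 1] decides
which of the two orbits contradicts [1 <= a ^+ 3 * B]. *)
Lemma auxiliary_lt1 (c : R[i]) :
  `|iter 3 (quadratic_map c) 0| <= 2 -> `|iter 3 (quadratic_map c) 1| <= 2 ->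
  `|(c + 1) ^+ 3 * (c * (c + 2))| < 1.
Proof.
case: c => x0 y; set c : R[i] := (_ +i* _)%C.
move=> /norm_le2 p3 /norm_le2 q3.
pose x := x0 + 1; pose a := x ^+ 2 + y ^+ 2.
pose B := (a + 1) ^+ 2 - 4 * x ^+ 2.
have normE : `|(c + 1) ^+ 3 * (c * (c + 2))| ^+ 2 = (a ^+ 3 * B)%:C%C.
  rewrite -add_Re2_Im2; congr (_%:C%C).
  rewrite !(exprS, expr0) /= /B /a /x; simpc => /=; ring.
rewrite -(@expr_lt1 _ 2) // normE ltcR ltNge; apply/negP => aB.
have a_gt0 : 0 < a.
  rewrite lt_def addr_ge0 ?sqr_ge0 // andbT.
  by apply: contraTneq aB => ->; rewrite expr0n mul0r ler10.
have defB : B + 4 * x ^+ 2 = (a + 1) ^+ 2 by rewrite /B subrK.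
have [x_ge0|x_lt0] := lerP 0 x.
  have := right_half_plane_escape a_gt0 defB aB x_ge0; apply/negP; rewrite -leNgt.
  apply: le_trans q3; rewrite le_eqVlt; apply/orP; left; apply/eqP.
  rewrite /= /quadratic_map !(exprS, expr0) /= /B /a /x /c; simpc => /=; ring.
have := left_half_plane_escape a_gt0 defB aB (ltW x_lt0); apply/negP; rewrite -leNgt.
apply: le_trans p3; rewrite le_eqVlt; apply/orP; left; apply/eqP.
rewrite /= /quadratic_map !(exprS, expr0) /= /B /a /x /c; simpc => /=; ring.
Qed.

End SquaredModulus.

(** * The parameters as roots of integer polynomials *)

Definition orbit_poly (z : int) (n : nat) : {poly int} :=
  iter n (fun p => p ^+ 2 + 'X) z%:P.

Lemma horner_orbit_poly (F : numFieldType) (c : F) z n :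
  (map_poly intr (orbit_poly z n)).[c] = iter n (quadratic_map c) z%:~R.
Proof.
elim: n => [|n IHn] /=; first by rewrite map_polyC hornerC.
by rewrite rmorphD rmorphXn /= map_polyX hornerD horner_exp hornerX IHn.
Qed.

Lemma root_collision_poly (F : numFieldType) (c : F) z m n :
  root (map_poly intr (orbit_poly z n - orbit_poly z m)) c =
  (iter m (quadratic_map c) z%:~R == iter n (quadratic_map c) z%:~R).
Proof.
rewrite rootE rmorphB hornerD hornerN /= !horner_orbit_poly subr_eq0.
by rewrite eq_sym.
Qed.

(** The degree doubles at each step, starting from the iterate [X]; the index
is shifted because the orbit starts at the zero polynomial. *)
Lemma orbit_poly_critical n :
  orbit_poly 0 n.+1 \is monic /\ size (orbit_poly 0 n.+1) = (2 ^ n).+1.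
Proof.
elim: n => [|n [mon_p size_p]].
  by rewrite /= expr0n add0r monicX size_polyX.
set p := orbit_poly 0 n.+1 in mon_p size_p *.
have -> : orbit_poly 0 n.+2 = p ^+ 2 + 'X by [].
have size_sqr : size (p ^+ 2) = (2 ^ n.+1).+1.
  by rewrite expr2 size_monicM ?monic_neq0 // size_p addSn addnS /= addnn -mul2n -expnS.
have ltX : (size ('X : {poly int}) < size (p ^+ 2)%R)%N.
  by rewrite size_sqr size_polyX ltnS expnS leq_pmulr ?expn_gt0.
rewrite monicE lead_coefDl // size_polyDl // size_sqr; split => //.
by rewrite -monicE monic_exp.
Qed.

Lemma critical_collision_monic m n : (m < n)%N ->
  orbit_poly 0 n - orbit_poly 0 m \is monic.
Proof.
case: n => // n lt_mn; have [mon_n size_n] := orbit_poly_critical n.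
rewrite monicE lead_coefDl -?monicE // size_polyN size_n.
case: m lt_mn => [|m] lt_mn; first by rewrite size_poly0.
by have [_ ->] := orbit_poly_critical m; rewrite ltnS ltn_exp2l.
Qed.

(** * Minimal polynomials and small values *)

(** The witness is the minimal polynomial of c over Q, which has integer
coefficients by Gauss's lemma.  The third property stands for Galois
conjugation: whatever integer equation c satisfies, its conjugates satisfy. *)
Lemma integral_minimal_poly (C : numClosedFieldType) (c : C) (P : {poly int}) :
  P \is monic -> root (map_poly intr P) c ->
  exists G : {poly int},
    [/\ G \is monic, root (map_poly intr G) c,
        forall (Q : {poly int}) (z : C), root (map_poly intr Q) c ->
          root (map_poly intr G) z -> root (map_poly intr Q) z &
        forall k : int, root G k -> c = k%:~R].
Proof.
move=> mon_P Pc0.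
have intC (Q : {poly int}) :
    map_poly (intr : int -> C) Q = map_poly (ratr : rat -> C) (map_poly intr Q).
  by rewrite -map_poly_comp; apply: eq_map_poly => k /=; rewrite ratr_int.
have int_c : integralOver (ratr : rat -> C) c.
  by exists (map_poly intr P); rewrite ?monic_map // -intC.
have [|p [mon_p pc0 irr_p]] :=
  minPoly_decidable_closure (FtoL := (ratr : {rmorphism rat -> C})) _ int_c.
  by move=> y; case: (pselect (exists x, y = ratr x)); [left|right].
have p_dvd (Q : {poly rat}) : root (map_poly ratr Q) c -> p %| Q.
  move=> Qc0; suff /eqp_dvdl <- : gcdp p Q %= p by apply: dvdp_gcdr.
  rewrite irr_p ?dvdp_gcdl // gtn_eqF // -(size_map_poly (ratr : {rmorphism rat -> C})).
  rewrite gcdp_map /= (@root_size_gt1 _ c) ?root_gcd ?pc0 //.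
  by rewrite gcdp_eq0 negb_and map_poly_eq0 monic_neq0.
have /dvdpP_rat_int [G0 [a a_neq0 defp] [r defP]] : p %| map_poly intr P.
  by apply: p_dvd; rewrite -intC.
have lead_mul : lead_coef G0 * lead_coef r = 1.
  by rewrite -lead_coefM -defP (monicP mon_P).
have lead_p : a * (lead_coef G0)%:~R = 1.
  have := monicP mon_p; rewrite defp lead_coefZ lead_coef_map_inj //.
  exact: intr_inj.
have aE : a = (lead_coef r)%:~R.
  have : a * ((lead_coef G0)%:~R * (lead_coef r)%:~R) = (lead_coef r)%:~R.
    by rewrite mulrA lead_p mul1r.
  by rewrite -intrM lead_mul mulr1.
(* The factor G0 provided by Gauss's lemma is only associate to p; the leading
   coefficient of its cofactor is the unit that corrects it. *)
exists (lead_coef r *: G0).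
have mapG : map_poly intr (lead_coef r *: G0) = p by rewrite map_polyZ /= -aE -defp.
split.
- by rewrite monicE lead_coefZ mulrC lead_mul.
- by rewrite intC mapG.
- move=> Q z; rewrite !intC mapG => /p_dvd pQ.
  by apply: root_dvdp; rewrite dvdp_map.
- move=> k Gk0; set l : {poly rat} := 'X - k%:~R%:P.
  have l_p : l %| p.
    rewrite dvdp_XsubCl -mapG rootE (horner_map (intr : {rmorphism int -> rat})).
    by rewrite (rootP Gk0).
  have : l %= p by apply: irr_p; rewrite ?size_XsubC.
  rewrite -(eqp_map (ratr : {rmorphism rat -> C})) => /eqp_root/(_ c).
  by rewrite pc0 map_polyXsubC root_XsubC /= ratr_int => /eqP.
Qed.

(** The product of the values of [\prod_(k <- ks) ('X - k)] at the roots of G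
is, up to sign, the product of the integers [G.[k]]: this resultant is an
integer of modulus less than 1. *)
Lemma integer_root_of_small_values (C : numClosedFieldType) (G : {poly int})
    (ks : seq int) (c : C) :
  G \is monic -> root (map_poly intr G) c ->
  (forall z : C, root (map_poly intr G) z -> \prod_(k <- ks) `|z - k%:~R| < 1) ->
  exists2 k, k \in ks & root G k.
Proof.
move=> mon_G Gc0 small.
have [rs defG] := closed_field_poly_normal (map_poly intr G : {poly C}).
rewrite (monicP (monic_map _ mon_G)) scale1r in defG.
have rsE z : (z \in rs) = root (map_poly intr G) z.
  by rewrite defG root_prod_XsubC.
have normG k : `|(G.[k])%:~R : C| = \prod_(z <- rs) `|z - k%:~R|.
  rewrite -(horner_map (intr : {rmorphism int -> C})) /= defG.
  rewrite horner_prod normr_prod; apply: eq_bigr => z _.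
  by rewrite hornerXsubC distrC.
pose N := \prod_(k <- ks) G.[k].
have N_lt1 : `|N%:~R : C| < 1.
  have -> : `|N%:~R : C| = \prod_(z <- rs) \prod_(k <- ks) `|z - k%:~R|.
    rewrite exchange_big /= /N rmorph_prod normr_prod.
    by apply: eq_bigr => k _; apply: normG.
  apply: (@lt_le_trans _ _ (\prod_(z <- rs) 1)); last by rewrite big1_eq.
  rewrite big_seq [ltRHS]big_seq; apply: ltr_prod => [|z].
    by apply/hasP; exists c; rewrite rsE.
  by rewrite rsE => /small ->; rewrite prodr_ge0.
have : N == 0.
  by move: N_lt1; rewrite -intr_norm ltrz1 -[1]add0r ltzD1 normr_le0.
rewrite /N prodf_seq_eq0 => /hasP[k k_ks /= Gk0].
by exists k.
Qed.

(** * The exceptional parameters and the field they generate *)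

Lemma S01_integer (R : rcfType) (c : R[i]) :
  S01 c -> exists2 k : int, k \in [:: 0; -1; -2] & c = k%:~R.
Proof.
case=> pre0 pre1.
have [m [n [lt_mn eq_mn]]] := preperiodic_collision pre0.
have [k [l [lt_kl eq_kl]]] := preperiodic_collision pre1.
have P0c : root (map_poly intr (orbit_poly 0 n - orbit_poly 0 m)) c.
  by rewrite root_collision_poly; apply/eqP.
have P1c : root (map_poly intr (orbit_poly 1 l - orbit_poly 1 k)) c.
  by rewrite root_collision_poly; apply/eqP.
have [G [mon_G Gc0 G_min G_int]] :=
  integral_minimal_poly (critical_collision_monic lt_mn) P0c.
(* The list repeats -1 because [c + 1] has exponent 3 in the auxiliary
   polynomial. *)
have [j j_ks /G_int ->] : exists2 j, j \in [:: -1; -1; -1; 0; -2] & root G j.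
  apply: (integer_root_of_small_values mon_G Gc0) => z Gz0.
  have := G_min _ z P0c Gz0; rewrite root_collision_poly => /eqP z_mn.
  have := G_min _ z P1c Gz0; rewrite root_collision_poly => /eqP z_kl.
  have := auxiliary_lt1 (collision_bounded 3 lt_mn z_mn lt_mn z_mn)
                        (collision_bounded 3 lt_mn z_mn lt_kl z_kl).
  rewrite !big_cons big_nil mulr1 !rmorphN rmorph0 subr0 !opprK.
  by rewrite !exprS expr0 mulr1 !normrM !mulrA.
by exists j => //; move: j_ks; rewrite !inE; do ?case: eqP.
Qed.

Lemma Qadjoin_ratr (F : numFieldType) (q : rat) :
  Qadjoin (ratr q : F) = range (ratr : rat -> F).
Proof.
apply/seteqP; split.
  apply: smallest_sub => [|_ ->]; last by exists q.
  split; rewrite ?inE.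
  - by exists 1; rewrite ?rmorph1.
  - move=> x y; rewrite !inE => -[a _ <-] [b _ <-].
    by exists (a - b); rewrite ?rmorphB.
  - move=> x y; rewrite !inE => -[a _ <-] [b _ <-].
    by exists (a / b); rewrite ?fmorph_div.
move=> _ [a _ <-] K [[K1 KB KD] _].
have K0 : 0 \in mem K by rewrite -(subrr 1) KB.
have KN x : x \in mem K -> - x \in mem K by move=> Kx; rewrite -sub0r KB.
have Knat n : n%:R \in mem K.
  by elim: n => // n IHn; rewrite -addn1 natrD -[1%:R]opprK KB // KN.
have Kint (k : int) : k%:~R \in mem K.
  by case: k => n; [exact: Knat | rewrite NegzE rmorphN KN //; exact: Knat].
by have := KD _ _ (Kint (numq a)) (Kint (denq a)); rewrite inE.
Qed.

Lemma Qdegree_rat (F : numFieldType) (q : rat) :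
  Qdegree (Qadjoin (ratr q : F)) 1.
Proof.
have combE (a : 'I_1 -> rat) : Qcomb (fun=> 1 : F) a = ratr (a ord0).
  by rewrite /Qcomb big_ord1 mulr1.
exists (fun=> 1); split=> [a|].
  rewrite combE => /eqP; rewrite fmorph_eq0 => /eqP a0 i.
  by rewrite ord1.
rewrite Qadjoin_ratr; apply/seteqP; split=> _ [a _ <-].
  by exists (fun=> a); rewrite ?combE.
by exists (a ord0); rewrite ?combE.
Qed.

Theorem theorem4 (R : realType) (c : R[i]) (hc : S01 c) :
  algebraicOver (ratr : rat -> R[i]) c /\
  exists2 d : nat, (d <= 108)%N & Qdegree (Qadjoin c) d.
Proof.
have [k _ ->] := S01_integer hc; rewrite -ratr_int.
split; first exact: algebraic_id.
by exists 1%N => //; exact: Qdegree_rat.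
Qed.
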